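(* Let $\mathcal{A}=A(1)\otimes_k A(1)$, and let $\mathcal{A}_s$ and $\mathcal{A}_a$ be the subspaces of symmetric and of anti-symmetric elements of $\mathcal{A}$, respectively. Then $\mathcal{A}_s$ and $\mathcal{A}_a$ are $\mathfrak{g}$-submodules of $\mathcal{A}$ and $\mathcal{A}=\mathcal{A}_s\oplus\mathcal{A}_a$ as $\mathfrak{g}$-modules.
   Context: $k$ is an algebraically closed field of characteristic $p>3$. $A(1)=k[X]/(X^p)$ with generator $x=X+(X^p)$; $\mathfrak{g}=W(1)=\mathrm{Der}(A(1))$ is the Witt algebra, with basis $e_i=x^{i+1}\partial$, $-1\le i\le p-2$, where $\partial=d/dx$, acting naturally on $A(1)$. The module $\mathcal{A}$ is identified with $k[X_1,X_2]/(X_1^p,X_2^p)$, with generators $x_1,x_2$, and the action is $e_j\cdot f=x_1^{j+1}\frac{\partial f}{\partial x_1}+x_2^{j+1}\frac{\partial f}{\partial x_2}$. The symmetric group $S_2$ acts on $\mathcal{A}$ by interchanging $x_1$ and $x_2$; $f$ is symmetric if $f(x_2,x_1)=f(x_1,x_2)$ and anti-symmetric if $f(x_2,x_1)=-f(x_1,x_2)$. *)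

(* Defs.v *)
From HB Require Import structures.
From mathcomp Require Import all_boot all_order all_fingroup all_algebra.
From mathcomp Require Import generic_quotient ring_quotient qpoly mpoly ring.

Set Implicit Arguments.
Unset Strict Implicit.
Unset Printing Implicit Defensive.

Import GRing.Theory.
Local Open Scope ring_scope.
Local Open Scope quotient_scope.

(* A(1) = k[X]/(X^p), with generator x = 'qX. *)
Notation A1 k p := {poly %/ ('X^p : {poly k})}.

Section Quotient.

Variables (k : fieldType) (p : nat) (pchark : p \in [pchar k]).

Let p_gt0 : (0 < p)%N. Proof. by have /andP[/prime_gt0] := pchark. Qed.

Let p_eq0 : p%:R = 0 :> k. Proof. by have /andP[_ /eqP] := pchark. Qed.

(* The ideal (X_1^p, X_2^p) of k[X_1, X_2], in the boolean form required by   *)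
(* {ideal_quot _}; see trunc_idealP. The proof that p is the characteristic   *)
(* of k is a parameter of the quotient type: it makes the ideal proper, and   *)
(* makes the partial derivatives descend to the quotient.                     *)
Definition trunc_ideal of p \in [pchar k] : pred {mpoly k[2]} :=
  fun f => all (fun m : 'X_{1..2} => [exists i, (p <= m i)%N]) (msupp f).

Local Notation I := (trunc_ideal pchark).

Lemma trunc_ideal_coefP (f : {mpoly k[2]}) :
  reflect (forall m : 'X_{1..2}, (forall i, (m i < p)%N) -> f@_m = 0) (f \in I).
Proof.
apply: (iffP allP) => [If m ltmp|If m].
  apply/eqP; rewrite mcoeff_eq0; apply/negP => /If /existsP[i].
  by rewrite leqNgt ltmp.
rewrite mcoeff_msupp; apply: contraR; rewrite negb_exists => /forallP ltmp.
by apply/eqP/If => i; rewrite ltnNge ltmp.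
Qed.

Fact trunc_ideal_closed : idealr_closed I.
Proof.
split=> [||a u v /trunc_ideal_coefP Iu /trunc_ideal_coefP Iv].
- by apply/trunc_ideal_coefP => m _; rewrite mcoeff0.
- apply/negP => /trunc_ideal_coefP/(_ 0%MM) I1; have /eqP := oner_neq0 k; apply.
  by rewrite -I1 ?mcoeff1 ?eqxx // => i; rewrite mnm0E.
apply/trunc_ideal_coefP => m ltmp.
rewrite mcoeffD Iv // addr0 mcoeffM big1 // => -[k1 k2] /= /eqP def_m.
rewrite Iu ?mulr0 // => i; apply: leq_ltn_trans (ltmp i).
by have /(congr1 (fun n : 'X_{1..2} => n i)) -> := def_m; rewrite mnmDE leq_addl.
Qed.

HB.instance Definition _ := isIdealr.Build {mpoly k[2]} I trunc_ideal_closed.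

Lemma trunc_idealP (f : {mpoly k[2]}) :
  f \in I <-> exists a b, f = a * 'X_ord0 ^+ p + b * 'X_ord_max ^+ p.
Proof.
have XpI i : 'X_i ^+ p \in I.
  apply/trunc_ideal_coefP => m /(_ i); rewrite mcoeffXn.
  by case: eqP => // <-; rewrite mulmnE mnm1E eqxx mul1n ltnn.
split=> [If|[a [b ->]]]; last by rewrite rpredD ?idealMr.
have XE (i : 'I_2) (m : 'X_{1..2}) : (p <= m i)%N ->
    'X_[m] = 'X_[m - U_(i) *+ p] * 'X_i ^+ p :> {mpoly k[2]}.
  move=> le_p; rewrite mpolyXn -mpolyXD; congr 'X_[_]; apply/mnmP => j.
  rewrite mnmDE mnmBE mulmnE mnm1E.
  by case: (i =P j) => [<-|_]; rewrite ?mul1n ?subnK // mul0n subn0 addn0.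
have {If} : forall m, m \in msupp f -> [exists i : 'I_2, (p <= m i)%N].
  exact/allP.
rewrite [X in _ -> exists a b, X = _](mpolyE f) big_seq => If.
apply: (big_ind (fun g => exists a b, g = a * 'X_ord0 ^+ p + b * 'X_ord_max ^+ p)).
- by exists 0, 0; rewrite !mul0r addr0.
- move=> _ _ [a [b ->]] [c [d ->]]; exists (a + c), (b + d).
  by rewrite !mulrDl addrACA.
move=> m /If/existsP[i /XE ->]; rewrite scalerAl.
have [->|->] : i = ord0 \/ i = ord_max.
- by case: i => -[|[|//]] lti; [left|right]; apply: val_inj.
- by exists (f@_m *: 'X_[m - U_(ord0) *+ p]), 0; rewrite mul0r addr0.
by exists 0, (f@_m *: 'X_[m - U_(ord_max) *+ p]); rewrite mul0r add0r.
Qed.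

(* A = A(1) (x) A(1), identified with k[X_1, X_2]/(X_1^p, X_2^p); the         *)
(* isomorphism maps a (x) b to trunc_inj ord0 a * trunc_inj ord_max b.        *)
Definition trunc_idealr : idealr {mpoly k[2]} := Idealr.clone _ I _.
Definition trunc : Type := {ideal_quot trunc_idealr}.

HB.instance Definition _ := GRing.ComNzRing.on trunc.
HB.instance Definition _ := EqQuotient.on trunc.

Local Notation A := trunc.

Fact pi_trunc_monoid_zmod :
  zmod_morphism (\pi_A : {mpoly k[2]} -> A)
  /\ monoid_morphism (\pi_A : {mpoly k[2]} -> A).
Proof.
split; first exact: (rmorphB (\pi_{ideal_quot trunc_idealr})).
by split; [exact: (rmorph1 (\pi_{ideal_quot trunc_idealr}))
          |exact: (rmorphM (\pi_{ideal_quot trunc_idealr}))].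
Qed.

Definition pi_trunc (f : {mpoly k[2]}) : A := \pi f.
HB.instance Definition _ := GRing.isZmodMorphism.Build _ _ pi_trunc
  pi_trunc_monoid_zmod.1.
HB.instance Definition _ := GRing.isMonoidMorphism.Build _ _ pi_trunc
  pi_trunc_monoid_zmod.2.

Lemma pi_truncK (f : A) : pi_trunc (repr f) = f.
Proof. exact: reprK. Qed.

Lemma pi_trunc_eq f g : (pi_trunc f == pi_trunc g) = (f - g \in I).
Proof. by rewrite [RHS]Quotient.idealrBE. Qed.

Definition trunc_scale (c : k) (f : A) : A := pi_trunc c%:MP * f.

Fact trunc_scaleA a b f : trunc_scale a (trunc_scale b f) = trunc_scale (a * b) f.
Proof. by rewrite /trunc_scale mulrA -rmorphM -mpolyCM. Qed.
Fact trunc_scale1 : left_id 1 trunc_scale.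
Proof. by move=> f; rewrite /trunc_scale rmorph1 mul1r. Qed.
Fact trunc_scaleDr : right_distributive trunc_scale +%R.
Proof. by move=> c f g; rewrite /trunc_scale mulrDr. Qed.
Fact trunc_scaleDl f : {morph trunc_scale^~ f : a b / a + b}.
Proof. by move=> a b; rewrite /trunc_scale !rmorphD mulrDl. Qed.
HB.instance Definition _ := GRing.Zmodule_isLmodule.Build k A
  trunc_scaleA trunc_scale1 trunc_scaleDr trunc_scaleDl.
Fact trunc_scaleAl (c : k) (f g : A) : c *: (f * g) = (c *: f) * g.
Proof. exact: mulrA. Qed.
HB.instance Definition _ := GRing.Lmodule_isLalgebra.Build k A trunc_scaleAl.
Fact trunc_scaleAr (c : k) (f g : A) : c *: (f * g) = f * (c *: g).
Proof. exact: mulrCA. Qed.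
HB.instance Definition _ := GRing.Lalgebra_isAlgebra.Build k A trunc_scaleAr.

Fact pi_trunc_scalable : scalable pi_trunc.
Proof. by move=> c f; rewrite -mul_mpolyC rmorphM. Qed.
HB.instance Definition _ := GRing.isScalable.Build k _ A *:%R pi_trunc
  pi_trunc_scalable.

(* The monomials x_1^i x_2^j with i, j < p form a basis of A. *)
Definition trunc_mnm (i j : 'I_p) : 'X_{1..2} := [multinom [tuple val i; val j]].

Definition trunc_coef (f : A) : 'M[k]_p :=
  \matrix_(i, j) (repr f)@_(trunc_mnm i j).

Definition trunc_of_coef (M : 'M[k]_p) : A :=
  pi_trunc (\sum_i \sum_j M i j *: 'X_[trunc_mnm i j]).

Lemma trunc_coef_pi f :
  trunc_coef (pi_trunc f) = \matrix_(i, j) f@_(trunc_mnm i j).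
Proof.
apply/matrixP => i j; rewrite !mxE; apply/eqP; rewrite -subr_eq0 -mcoeffB.
have : repr (pi_trunc f) - f \in I by rewrite -pi_trunc_eq pi_truncK.
move=> /trunc_ideal_coefP -> //.
by case=> -[|[|//]] lt_i2; rewrite multinomE (tnth_nth 0%N) /=.
Qed.

Lemma trunc_coef_linear : linear trunc_coef.
Proof.
move=> c f g; rewrite -[f]pi_truncK -[g]pi_truncK -linearP !trunc_coef_pi.
by apply/matrixP => i j; rewrite !mxE mcoeffD mcoeffZ.
Qed.

Lemma trunc_of_coefK : cancel trunc_of_coef trunc_coef.
Proof.
move=> M; rewrite trunc_coef_pi; apply/matrixP => i j.
have mnmE i1 j1 : trunc_mnm i1 j1 == trunc_mnm i j = (i1 == i) && (j1 == j).
  by rewrite -val_eqE /= -val_eqE /= !eqseq_cons andbT.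
rewrite !mxE raddf_sum (bigD1 i) //= raddf_sum (bigD1 j) //= mcoeffZ mcoeffX.
rewrite mnmE !eqxx mulr1 !big1 ?addr0 // => [i1 /negPf ne_i|j1 /negPf ne_j].
  by rewrite raddf_sum big1 // => j1 _; rewrite /= mcoeffZ mcoeffX mnmE ne_i mulr0.
by rewrite mcoeffZ mcoeffX mnmE ne_j andbF mulr0.
Qed.

Lemma trunc_coefK : cancel trunc_coef trunc_of_coef.
Proof.
move=> f; rewrite -{2}[f]pi_truncK; apply/eqP; rewrite pi_trunc_eq.
apply/trunc_ideal_coefP => m ltmp; rewrite mcoeffB; apply/eqP; rewrite subr_eq0.
have -> : m = trunc_mnm (Ordinal (ltmp ord0)) (Ordinal (ltmp ord_max)).
  apply/mnmP => -[[|[|//]] lt_i2]; rewrite multinomE (tnth_nth 0%N) /=;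
    by congr (m _); apply: val_inj.
have := trunc_of_coefK (trunc_coef f); rewrite trunc_coef_pi.
by move=> /matrixP/(_ (Ordinal (ltmp ord0)) (Ordinal (ltmp ord_max))); rewrite !mxE => ->.
Qed.

Fact trunc_vect_axiom : Vector.axiom (p * p) A.
Proof.
exists (mxvec \o trunc_coef).
  by move=> c f g; rewrite /= trunc_coef_linear linearP.
exists (trunc_of_coef \o vec_mx) => x /=; first by rewrite mxvecK trunc_coefK.
by rewrite trunc_of_coefK vec_mxK.
Qed.
HB.instance Definition _ := Lmodule_hasFinDim.Build k A trunc_vect_axiom.

(* The partial derivative d/dx_i on A. *)
Definition trunc_deriv (i : 'I_2) (f : A) : A := pi_trunc (repr f)^`M(i).

Lemma trunc_deriv_pi i f : trunc_deriv i (pi_trunc f) = pi_trunc f^`M(i).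
Proof.
apply/eqP; rewrite pi_trunc_eq -mderivB; apply/trunc_ideal_coefP => m ltmp.
have : repr (pi_trunc f) - f \in I by rewrite -pi_trunc_eq pi_truncK.
move: (_ - f) => g /trunc_ideal_coefP Ig; rewrite mcoeff_deriv.
have [lt_mi|] := ltnP (m i).+1 p.
  rewrite Ig ?mul0rn // => j; rewrite mnmDE mnm1E.
  by case: (i =P j) => [<-|_]; rewrite ?addn1 // addn0.
move=> le_p; have -> : (m i).+1 = p by apply/eqP; rewrite eqn_leq ltmp le_p.
by rewrite -mulr_natr p_eq0 mulr0.
Qed.

Lemma trunc_deriv_linear i : linear (trunc_deriv i).
Proof.
move=> c f g; rewrite -[f]pi_truncK -[g]pi_truncK -linearP !trunc_deriv_pi.
by rewrite -linearP mderivD mderivZ.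
Qed.
HB.instance Definition _ i := GRing.isLinear.Build k A A *:%R (trunc_deriv i)
  (trunc_deriv_linear i).

Lemma trunc_derivM i f g :
  trunc_deriv i (f * g) = trunc_deriv i f * g + f * trunc_deriv i g.
Proof.
rewrite -[f]pi_truncK -[g]pi_truncK -rmorphM !trunc_deriv_pi.
by rewrite mderivM rmorphD !rmorphM.
Qed.

(* The action of the transposition of S_2 on A, exchanging x_1 and x_2. *)
Definition trunc_swap (f : A) : A :=
  pi_trunc (msym (tperm ord0 ord_max) (repr f)).

Lemma trunc_swap_pi f :
  trunc_swap (pi_trunc f) = pi_trunc (msym (tperm ord0 ord_max) f).
Proof.
apply/eqP; rewrite pi_trunc_eq -msymB; apply/trunc_ideal_coefP => m ltmp.
have : repr (pi_trunc f) - f \in I by rewrite -pi_trunc_eq pi_truncK.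
move=> /trunc_ideal_coefP Ig; rewrite mcoeff_sym Ig // => j.
by rewrite mnmE.
Qed.

Lemma trunc_swap_linear : linear trunc_swap.
Proof.
move=> c f g; rewrite -[f]pi_truncK -[g]pi_truncK -linearP !trunc_swap_pi.
by rewrite -linearP msymD msymZ.
Qed.
HB.instance Definition _ := GRing.isLinear.Build k A A *:%R trunc_swap
  trunc_swap_linear.

Definition trunc_sym : {vspace A} := lker (linfun trunc_swap - \1)%VF.
Definition trunc_antisym : {vspace A} := lker (linfun trunc_swap + \1)%VF.

Lemma mem_trunc_sym f : (f \in trunc_sym) = (trunc_swap f == f).
Proof. by rewrite memv_ker !lfunE /= opp_lfunE !lfunE /= subr_eq0. Qed.

Lemma mem_trunc_antisym f : (f \in trunc_antisym) = (trunc_swap f == - f).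
Proof. by rewrite memv_ker !lfunE /= !lfunE /= addr_eq0. Qed.

(* The embedding A(1) -> A, a(x) |-> a(x_i). *)
Definition trunc_inj (i : 'I_2) (a : A1 k p) : A :=
  (map_poly (in_alg A) a).[pi_trunc 'X_i].

Let mk_monicXp : mk_monic ('X^p : {poly k}) = 'X^p.
Proof. by rewrite mk_monic_Xn prednK. Qed.

Lemma trunc_inj_in_qpoly i (q : {poly k}) :
  trunc_inj i (in_qpoly _ q) = (map_poly (in_alg A) q).[pi_trunc 'X_i].
Proof.
rewrite {2}(Pdiv.RingMonic.rdivp_eq (monic_mk_monic 'X^p) q) rmorphD rmorphM /=.
rewrite {2}mk_monicXp map_polyXn hornerD hornerM hornerXn.
have /eqP -> : pi_trunc 'X_i ^+ p == 0; last by rewrite mulr0 add0r.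
rewrite -rmorphXn -(rmorph0 pi_trunc) pi_trunc_eq subr0; apply/trunc_ideal_coefP => m /(_ i).
by rewrite mcoeffXn; case: eqP => // <-; rewrite mulmnE mnm1E eqxx mul1n ltnn.
Qed.

Lemma in_qpolyK (a : A1 k p) : in_qpoly _ a = a.
Proof. by apply/val_inj/in_qpoly_small/size_mk_monic. Qed.

Lemma trunc_inj_linear i : linear (trunc_inj i).
Proof.
move=> c a b; rewrite /trunc_inj /= linearP /= hornerD.
by rewrite hornerZ -[RHS]/(_ *: _ + _) mulr_algl.
Qed.
HB.instance Definition _ i := GRing.isLinear.Build k (A1 k p) A *:%R
  (trunc_inj i) (trunc_inj_linear i).

Lemma trunc_inj_monoid i : monoid_morphism (trunc_inj i).
Proof.
split; first by rewrite -in_qpoly1 trunc_inj_in_qpoly rmorph1 hornerC.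
move=> a b; rewrite -[a in LHS]in_qpolyK -[b in LHS]in_qpolyK -in_qpolyM.
by rewrite trunc_inj_in_qpoly rmorphM hornerM.
Qed.
HB.instance Definition _ i := GRing.isMonoidMorphism.Build (A1 k p) A
  (trunc_inj i) (trunc_inj_monoid i).

Lemma trunc_inj_X i : trunc_inj i 'qX = pi_trunc 'X_i.
Proof. by rewrite trunc_inj_in_qpoly map_polyX hornerX. Qed.

(* g = W(1) = Der(A(1)): the k-linear derivations of A(1). *)
Definition witt (D : 'End(A1 k p)) : Prop :=
  forall a b, D (a * b) = D a * b + a * D b.

Definition witt_bracket (D E : 'End(A1 k p)) : 'End(A1 k p) :=
  ((D \o E) - (E \o D))%VF.

(* The derivation d/dx of A(1), and e_(n - 1) = x^n d/dx for 0 <= n < p. *)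
Definition A1_deriv (a : A1 k p) : A1 k p := in_qpoly _ (a : {poly k})^`().

Lemma A1_deriv_linear : linear A1_deriv.
Proof. by move=> c a b; rewrite /A1_deriv /= linearP /= in_qpolyD in_qpolyZ. Qed.
HB.instance Definition _ := GRing.isLinear.Build k (A1 k p) (A1 k p) *:%R
  A1_deriv A1_deriv_linear.

Definition witt_e (n : nat) : 'End(A1 k p) :=
  linfun ('qX ^+ n \*o A1_deriv).

(* The action of a derivation D = D(x) d/dx of A(1) on A, i.e. the linear     *)
(* extension of e_j . f = x_1^(j+1) df/dx_1 + x_2^(j+1) df/dx_2; by           *)
(* witt_act_tensor this is D (x) 1 + 1 (x) D on A(1) (x) A(1).                *)
Definition witt_act (D : 'End(A1 k p)) (f : A) : A :=
  \sum_(i < 2) trunc_inj i (D 'qX) * trunc_deriv i f.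

Definition witt_submodule (U : {vspace A}) : Prop :=
  forall D, witt D -> {in U, forall f, witt_act D f \in U}.

Lemma A1_deriv_in_qpoly (q : {poly k}) : A1_deriv (in_qpoly _ q) = in_qpoly _ q^`().
Proof.
have [r [q' [rE qE]]] : exists r q' : {poly k}, in_qpoly 'X^p q = r :> {poly k} /\ q = q' * 'X^p + r.
  exists (Pdiv.Ring.rmodp q (mk_monic 'X^p)), (Pdiv.Ring.rdivp q (mk_monic 'X^p)).
  split=> //; rewrite -[X in _ * X + _]mk_monicXp.
  exact/Pdiv.RingMonic.rdivp_eq/monic_mk_monic.
rewrite /A1_deriv rE qE derivD derivM derivXn -mulr_natr -polyC_natr p_eq0.
rewrite !mulr0 addr0.
rewrite in_qpolyD in_qpolyM; have -> : in_qpoly 'X^p 'X^p = 0 :> A1 k p.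
  by apply: val_inj; rewrite /= mk_monicXp Pdiv.RingMonic.rmodpp ?monicXn.
by rewrite mulr0 add0r.
Qed.

Lemma A1_derivM a b : A1_deriv (a * b) = A1_deriv a * b + a * A1_deriv b.
Proof.
rewrite -{1}[a]in_qpolyK -{1}[b]in_qpolyK -in_qpolyM A1_deriv_in_qpoly derivM.
by rewrite in_qpolyD !in_qpolyM !in_qpolyK.
Qed.

Lemma witt_eE n a : witt_e n a = 'qX ^+ n * A1_deriv a.
Proof. by rewrite lfunE. Qed.

Lemma witt_e_witt n : witt (witt_e n).
Proof. by move=> a b; rewrite !witt_eE A1_derivM mulrDr mulrA mulrCA. Qed.

Lemma witt_derivE D a : witt D -> D a = D 'qX * A1_deriv a.
Proof.
move=> derD; rewrite -[a]in_qpolyK A1_deriv_in_qpoly.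
have D1 : D 1 = 0.
  by apply: (addrI (D 1)); rewrite -{1}[D 1]mulr1 -{2}[D 1]mul1r -derD mulr1 addr0.
elim/poly_ind: (qpoly.polyn a) => [|q c IHq]; first by rewrite deriv0 !linear0 mulr0.
rewrite derivMXaddC !linearD /= !in_qpolyM -[in_qpoly _ 'X]/('qX) derD IHq.
rewrite -alg_polyC !linearZ /= in_qpoly1 D1 scaler0 addr0.
by rewrite mulrDr addrC [_ * D _]mulrC mulrA.
Qed.

(* The e_j span Der(A(1)). *)
Lemma witt_span D : witt D ->
  D = \sum_(n < p) (D 'qX : {poly k})`_n *: witt_e n.
Proof.
move=> derD; apply/lfunP => a; rewrite witt_derivE // sum_lfunE.
under eq_bigr => n _ do rewrite scale_lfunE witt_eE scalerAl.
rewrite -mulr_suml; congr (_ * _).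
rewrite -{1}[D 'qX]in_qpolyK -{1}[qpoly.polyn _]coefK poly_def.
rewrite linear_sum /=.
under eq_bigr => n _ do rewrite linearZ /= rmorphXn /=.
have le_p : (size (D 'qX : {poly k}) <= p)%N.
  rewrite -ltnS; apply: leq_trans (size_mk_monic (D 'qX)) _.
  by rewrite mk_monicXp size_polyXn.
rewrite (big_ord_widen p (fun n => (D 'qX : {poly k})`_n *: 'qX ^+ n)) //.
rewrite big_mkcond; apply: eq_bigr => n _; case: ltnP => // ge_n.
by rewrite nth_default // scale0r.
Qed.

Lemma witt_act_e n f :
  witt_act (witt_e n) f = pi_trunc 'X_ord0 ^+ n * trunc_deriv ord0 f
                        + pi_trunc 'X_ord_max ^+ n * trunc_deriv ord_max f.
Proof.
rewrite /witt_act big_ord_recl big_ord1 witt_eE.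
have -> : A1_deriv 'qX = 1 by rewrite A1_deriv_in_qpoly derivX in_qpoly1.
rewrite mulr1 !rmorphXn /= !trunc_inj_X.
by congr (_ + pi_trunc 'X__ ^+ n * trunc_deriv _ f); apply: val_inj.
Qed.

Lemma trunc_deriv_inj i j a :
  trunc_deriv i (trunc_inj j a) = if i == j then trunc_inj i (A1_deriv a) else 0.
Proof.
rewrite -[a]in_qpolyK A1_deriv_in_qpoly !trunc_inj_in_qpoly.
elim/poly_ind: (qpoly.polyn a) => [|q c IHq].
  by rewrite deriv0 rmorph0 !horner0 linear0 if_same.
rewrite derivMXaddC !rmorphD !rmorphM /= map_polyX map_polyC /= !hornerE.
rewrite linearD /= trunc_derivM IHq linearZ /=.
have -> : trunc_deriv i 1 = 0 by rewrite -(rmorph1 pi_trunc) trunc_deriv_pi -mpolyC1 mderivC rmorph0.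
rewrite trunc_deriv_pi scaler0 addr0 mderivX mnm1E.
rewrite eq_sym; case: eqP => [->|_]; last by rewrite scale0r rmorph0 mulr0 mul0r addr0.
have -> : (U_(i) - U_(i))%MM = 0%MM :> 'X_{1..2}.
  by apply/mnmP => l; rewrite mnmBE subnn mnm0E.
by rewrite scale1r mpolyX0 rmorph1 mulr1 [RHS]addrC.
Qed.

(* The action on A(1) (x) A(1) is the tensor product of two copies of A(1). *)
Lemma witt_act_tensor D a b : witt D ->
  witt_act D (trunc_inj ord0 a * trunc_inj ord_max b) =
  trunc_inj ord0 (D a) * trunc_inj ord_max b
  + trunc_inj ord0 a * trunc_inj ord_max (D b).
Proof.
move=> derD; rewrite /witt_act big_ord_recl big_ord1.
have -> : lift ord0 ord0 = ord_max :> 'I_2 by apply: val_inj.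
rewrite !trunc_derivM !trunc_deriv_inj !eqxx /= mulr0 addr0 mul0r add0r.
by rewrite (witt_derivE a derD) (witt_derivE b derD) !rmorphM mulrA mulrCA.
Qed.

Lemma witt_act_linear D : linear (witt_act D).
Proof.
move=> c f g; rewrite /witt_act scaler_sumr -big_split /=; apply: eq_bigr => i _.
by rewrite linearP mulrDr scalerAr.
Qed.

Lemma witt_act_linearl f : linear (witt_act^~ f).
Proof.
move=> c D E; rewrite /witt_act scaler_sumr -big_split /=; apply: eq_bigr => i _.
by rewrite add_lfunE scale_lfunE linearP mulrDl scalerAl.
Qed.

Lemma witt_bracketP D E : witt D -> witt E -> witt (witt_bracket D E).
Proof.
move=> derD derE a b; rewrite !(add_lfunE, opp_lfunE, comp_lfunE).
rewrite derD derE !linearD /= !derD !derE mulrBl mulrBr; ring.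
Qed.

Lemma trunc_deriv_comm i j f :
  trunc_deriv i (trunc_deriv j f) = trunc_deriv j (trunc_deriv i f).
Proof. by rewrite -[f]pi_truncK !trunc_deriv_pi mderiv_comm. Qed.

Lemma witt_act_bracket D E f : witt D -> witt E ->
  witt_act (witt_bracket D E) f =
  witt_act D (witt_act E f) - witt_act E (witt_act D f).
Proof.
move=> derD derE; rewrite /witt_act !big_ord_recl !big_ord0 !addr0.
have -> : lift ord0 ord0 = ord_max :> 'I_2 by apply: val_inj.
rewrite !(add_lfunE, opp_lfunE, comp_lfunE) !linearB !linearD /=.
rewrite !trunc_derivM !trunc_deriv_inj /= [trunc_deriv ord_max (_ ord0 _)]trunc_deriv_comm.
rewrite (witt_derivE (D 'qX) derE) (witt_derivE (E 'qX) derD) !rmorphM /=.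
ring.
Qed.

Lemma trunc_swapM f g : trunc_swap (f * g) = trunc_swap f * trunc_swap g.
Proof.
rewrite -[f]pi_truncK -[g]pi_truncK -rmorphM !trunc_swap_pi -rmorphM.
by congr (pi_trunc _); rewrite /msym rmorphM.
Qed.

Lemma trunc_swap_inj i a :
  trunc_swap (trunc_inj i a) = trunc_inj (tperm ord0 ord_max i) a.
Proof.
rewrite /trunc_inj; elim/poly_ind: (qpoly.polyn a) => [|q c IHq].
  by rewrite rmorph0 !horner0 linear0.
rewrite !rmorphD !rmorphM /= map_polyX map_polyC /= !hornerE.
rewrite linearD /= trunc_swapM IHq linearZ /= trunc_swap_pi.
have -> : trunc_swap 1 = 1.
  by rewrite -(rmorph1 pi_trunc) trunc_swap_pi /msym !rmorph1.
by rewrite /msym mmapX mmap1U.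
Qed.

End Quotient.

(* Main.v *)
Require Import Defs.
From mathcomp Require Import all_boot all_order all_algebra.
From mathcomp Require Import fingroup perm mpoly.

(** The swap of x_1 and x_2 is an involution of A that commutes with the
    Witt algebra: it carries d/dx_i to d/dx_(s i) and a(x_i) to a(x_(s i)),
    where s is the transposition, so it merely permutes the two summands
    D(x_1) d/dx_1 and D(x_2) d/dx_2 by which a derivation D acts
    ([trunc_swap_witt_act]). Its eigenspaces for 1 and -1, which are the
    symmetric and the anti-symmetric elements, are therefore submodules.
    Since the characteristic is odd, 2 is invertible: every f is
    (f + swap f)/2 + (f - swap f)/2, and an element that is at once symmetric
    and anti-symmetric satisfies 2f = 0, hence vanishes. *)

Import GRing.Theory.
Local Open Scope ring_scope.

(** The chain rule for a permutation of the variables. In degree m, both sides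
    are the coefficient of f in degree (m + U_(s i)) o s = m o s + U_i, with
    multiplicity m (s i) + 1. *)
Lemma msym_mderiv (n : nat) (R : comNzRingType) (s : 'S_n) (i : 'I_n)
    (f : {mpoly R[n]}) :
  msym s f^`M(i) = (msym s f)^`M(s i).
Proof.
apply/mpolyP => m; rewrite mcoeff_sym !mcoeff_deriv mcoeff_sym mnmE.
congr (f@_ _ *+ _); apply/mnmP => j.
by rewrite !(mnmDE, mnmE, mnm1E) (inj_eq perm_inj).
Qed.

Lemma trunc_swap_deriv (k : fieldType) (p : nat) (pchark : p \in [pchar k])
    (i : 'I_2) (f : trunc pchark) :
  trunc_swap (trunc_deriv i f)
  = trunc_deriv (tperm ord0 ord_max i) (trunc_swap f).
Proof.
rewrite -[f]pi_truncK trunc_deriv_pi !trunc_swap_pi trunc_deriv_pi.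
by rewrite msym_mderiv.
Qed.

Lemma trunc_swapK (k : fieldType) (p : nat) (pchark : p \in [pchar k]) :
  involutive (@trunc_swap k p pchark).
Proof.
move=> f; rewrite -[f]pi_truncK !trunc_swap_pi; congr (pi_trunc _ _).
apply/mpolyP => m; rewrite !mcoeff_sym; congr (_@__); apply/mnmP => j.
by rewrite !mnmE tpermK.
Qed.

(** The swap exchanges the two terms of the sum that defines the action; this
    needs only that D acts by the same coefficient D(x) in both variables, and
    makes every swap eigenspace a submodule. *)
Lemma trunc_swap_witt_act (k : fieldType) (p : nat) (pchark : p \in [pchar k])
    (D : 'End(A1 k p)) (f : trunc pchark) :
  trunc_swap (witt_act D f) = witt_act D (trunc_swap f).
Proof.
rewrite /witt_act linear_sum [RHS](reindex_inj (@perm_inj _ (tperm ord0 ord_max))).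
by apply: eq_bigr => i _; rewrite /= trunc_swapM trunc_swap_inj trunc_swap_deriv.
Qed.

Theorem lemma4p1 (k : closedFieldType) (p : nat) (pchark : p \in [pchar k]%R)
    (p_gt3 : (3 < p)%N) :
  [/\ witt_submodule (trunc_sym pchark),
      witt_submodule (trunc_antisym pchark),
      (trunc_sym pchark + trunc_antisym pchark)%VS = fullv
    & directv (trunc_sym pchark + trunc_antisym pchark)%VS].
Proof.
have two_neq0 : 2%:R != 0 :> k.
  by rewrite -(dvdn_pcharf pchark) gtnNdvd // ltnW.
split.
- move=> D _ f; rewrite !mem_trunc_sym => /eqP swap_f.
  by rewrite trunc_swap_witt_act swap_f.
- move=> D _ f; rewrite !mem_trunc_antisym => /eqP swap_f.
  rewrite trunc_swap_witt_act swap_f /witt_act -sumrN; apply/eqP.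
  by apply: eq_bigr => i _; rewrite linearN mulrN.
- apply/vspaceP => f; rewrite memvf.
  have -> : f = 2%:R^-1 *: (f + trunc_swap f) + 2%:R^-1 *: (f - trunc_swap f).
    rewrite -scalerDr addrACA subrr addr0 -mulr2n -scaler_nat scalerA.
    by rewrite mulVf // scale1r.
  apply: memv_add; apply: memvZ.
    by rewrite mem_trunc_sym linearD /= trunc_swapK addrC.
  by rewrite mem_trunc_antisym linearB /= trunc_swapK opprB.
apply/directv_addP/eqP; rewrite -subv0; apply/subvP => f.
rewrite memv_cap mem_trunc_sym mem_trunc_antisym => /andP[/eqP ->].
rewrite -addr_eq0 -mulr2n -scaler_nat scaler_eq0 (negPf two_neq0) /=.
by move/eqP ->; apply: mem0v.
Qed.
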